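(* There is a social choice function (for facility location on $[0,1]$ with single-peaked preferences and tree-shaped invitation networks) that satisfies strategy-proofness over networks (SP), Pareto efficiency (PE), anonymity on structure-distance pairs (AN-SD), and $2$-distance voter-relevance (VR-$2$).
   Context: Outcomes and preferences. The outcome set is $\mathcal{O}=[0,1]$. A preference is a complete and transitive binary relation $\succsim$ on $\mathcal{O}$ (strict part $\succ$). It is single-peaked if there is a point $p\in\mathcal{O}$ (its peak) such that for all distinct $x,y\in\mathcal{O}$: if $p\le x<y$ or $y<x\le p$ then $x\succ y$. Let $\mathcal{R}$ be the set of single-peaked preferences. The peak of voter $i$'s preference $\succ_i$ is denoted $p_i$. Networks and types. $\mathcal{N}$ is the set of potential voters and $m\notin\mathcal{N}$ is the moderator. The set $r_m\subseteq\mathcal{N}$ consists of the children of $m$, and for each voter $i$ the set $r_i\subseteq\mathcal{N}\setminus\{i\}$ consists of the children of $i$. Together, $r_m$ and $(r_i)_{i\in\mathcal{N}}$ specify the social network $G$ (a directed edge from each parent to each of its children), which is assumed to be a directed tree with single source $m$. The true type of voter $i$ is $\theta_i=(\succ_i,r_i)$ with $\succ_i\in\mathcal{R}$; $\theta=(\theta_i)_i$ is a type profile and $\theta_{-i}$ is the profile of the types of the voters other than $i$. The set $r_m$ is not part of any type and is not reported by any voter. Reports. A voter with true type $\theta_i=(\succ_i,r_i)$ can report (as her action) any element of $R(\theta_i)=\{(\succ_i',r_i') : \succ_i'\in\mathcal{R},\ r_i'\subseteq r_i\}$. Write $\theta'_{-i}\in R(\theta_{-i})$ if $\theta_j'\in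 R(\theta_j)$ for all $j\ne i$, and $\theta'\in R(\theta)$ if $\theta'_j\in R(\theta_j)$ for all $j$. Given a reported profile $\theta'$, the participating voters $\hat N(\theta')$ are those to whom there is a directed path from $m$ in the network formed by $r_m$ and the reported sets $r_i'$. Social choice function (SCF). An SCF $f$ is deterministic and maps each reported profile $\theta'\in R(\theta)$ to an outcome in $\mathcal{O}$, where $f$ can use only the reported preferences and reported children of the participating voters $\hat N(\theta')$. It is defined for every set of participating voters. SP. $f$ is strategy-proof over networks if for any set $N\subseteq\mathcal{N}$ of voters, any $i\in N$, any $\theta_{-i}$, any $\theta'_{-i}\in R(\theta_{-i})$, any $\theta_i=(\succ_i,r_i)$ and any $\theta'_i\in R(\theta_i)$: $f(\theta_i,\theta'_{-i})\succsim_i f(\theta'_i,\theta'_{-i})$. PE. $f$ is Pareto efficient if for every profile $\theta$ there is no outcome $o\in\mathcal{O}$ with $o\succsim_i f(\theta)$ for all participating voters $i$ and $o\succ_i f(\theta)$ for some participating voter $i$. AN-SD. Given a social network, let $N_S(k)$ be the set of participating voters who have $k$ children, and $N_D(d)$ the set of participating voters at distance $d$ from $m$ (number of edges of the directed path). $f$ satisfies AN-SD if for any $\theta$, any pair of integers $k,d\ge 0$, and any $\theta'$ obtained from $\theta$ by having any subset of the voters in $N_S(k)\cap N_D(d)$ permute their preferences, $f(\theta)=f(\theta')$. VR-$d$. For an integer $d\ge 0$, $f$ is $d$-distance voter-relevant if, for any voter $i\in\bigcup_{1\le d'\le d}N_D(d')$ (the sets $N_D(d')$ being those of the given social network) and any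 $\theta_i$, there exists a profile $\theta'_{-i}$ of the other voters' actions such that $f(\theta'_i,\theta'_{-i})\ne f(\theta''_i,\theta'_{-i})$ for some $\theta'_i,\theta''_i\in R(\theta_i)$.
   Formalization: VR-2 is required only in networks where the moderator does not have exactly one child, or where no voter is at distance 2; in the excluded networks SP and PE force the outcome to be the only child's peak, so no voter at distance 2 can be relevant. *)

(* Defs.v *)
From mathcomp Require Import all_boot all_order all_algebra finmap.
From mathcomp Require Import classical_sets interval_inference reals.

Set Implicit Arguments.
Unset Strict Implicit.
Unset Printing Implicit Defensive.

Import Order.TTheory GRing.Theory Num.Theory.
Local Open Scope fset_scope.
Local Open Scope ring_scope.

Definition outcome (R : realType) := {i01 R}.

Section Preferences.
Variable R : realType.

Definition strict (w : outcome R -> outcome R -> Prop) (x y : outcome R) :=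
  w x y /\ ~ w y x.

Definition is_peak (w : outcome R -> outcome R -> Prop) (p : outcome R) :=
  forall x y : outcome R,
    (p <= x /\ x < y) \/ (y < x /\ x <= p) -> strict w x y.

(* [weakly s x y] reads "x is at least as good as y"; no continuity and no
   comparability across the two sides of the peak is imposed. *)
Record sp_preference := SPPreference {
  weakly :> outcome R -> outcome R -> Prop;
  weakly_complete : forall x y, weakly x y \/ weakly y x;
  weakly_trans : forall x y z, weakly x y -> weakly y z -> weakly x z;
  weakly_single_peaked : exists p, is_peak weakly p }.

End Preferences.

Section Networks.
Variables (R : realType) (V : choiceType).
(* [V] is the set of potential voters; it may be infinite, but the voters of a
   given network form a finite set. *)

Record vtype := VType { pref : sp_preference R; children : {fset V} }.

Definition profile := V -> vtype.

Implicit Types (rm N : {fset V}) (t : profile).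

(* Nodes are [option V]: [None] is the moderator, whose children are [rm]. *)
Definition edge rm t : rel (option V) := fun u v =>
  match u, v with
  | _, None => false
  | None, Some j => j \in rm
  | Some i, Some j => j \in children (t i)
  end.

(* [s] lists the nodes of the path other than its origin, so that [size s] is
   its number of edges. *)
Definition path_to rm t (i : V) (s : seq (option V)) : bool :=
  path (edge rm t) None s && (last None s == Some i).

Definition participants rm t : set V := [set i | exists s, path_to rm t i s].

Definition N_D rm t (d : nat) : set V :=
  [set i | exists2 s, path_to rm t i s & size s = d].

Definition N_S rm t (k : nat) : set V :=
  [set i | participants rm t i /\ #|` children (t i)| = k].

(* The voters in [N], with the moderator, form a directed tree with source the
   moderator.  The values of [t] outside [N] are meaningless. *)
Definition social_network N rm t : Prop :=
  [/\ rm `<=` N,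
      forall i, i \in N -> children (t i) `<=` N `\ i
    & forall i, i \in N -> exists! s, path_to rm t i s].

Definition can_report (a b : vtype) : bool := children b `<=` children a.

Definition reports N t t' : Prop :=
  forall i, i \in N -> can_report (t i) (t' i).

(* The profiles to which a social choice function is applied (the truthful
   ones included). *)
Definition reported_profile rm t' : Prop :=
  exists N t, social_network N rm t /\ reports N t t'.

Definition update t (i : V) (a : vtype) : profile :=
  fun j => if j == i then a else t j.

(* The moderator knows her own children [rm]; of the reports, only those of
   the participating voters can be used. *)
Record scf := SCF {
  scf_fun :> {fset V} -> profile -> outcome R;
  scf_local : forall rm t t',
    (forall i, participants rm t i -> t i = t' i) ->
    scf_fun rm t = scf_fun rm t' }.

Implicit Type f : scf.

(* [t'] collects the reports of the others and the possible misreport of [i]. *)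
Definition SP f : Prop :=
  forall N rm t t' i, social_network N rm t -> i \in N -> reports N t t' ->
    pref (t i) (f rm (update t' i (t i))) (f rm t').

Definition PE f : Prop :=
  forall rm t, reported_profile rm t ->
    ~ exists o : outcome R,
        (forall i, participants rm t i -> pref (t i) o (f rm t)) /\
        (exists2 i, participants rm t i & strict (pref (t i)) o (f rm t)).

Definition permute_prefs (s : V -> V) t : profile :=
  fun i => VType (pref (t (s i))) (children (t i)).

Definition AN_SD f : Prop :=
  forall rm t (k d : nat) (s : V -> V), reported_profile rm t ->
    bijective s ->
    (forall i, ~ (N_S rm t k `&` N_D rm t d)%classic i -> s i = i) ->
    f rm (permute_prefs s t) = f rm t.

(* Voter relevance in a given social network.  When the moderator has a single
   child [a], that child can withhold all invitations, so [SP] and [PE] force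
   the outcome to be the peak of [a] and no voter at distance 2 can be
   relevant; [VR 2] is attainable in all the other networks. *)
Definition VR (d : nat) f N rm t : Prop :=
  forall (d' : nat) i, (1 <= d' <= d)%N -> N_D rm t d' i ->
    exists t', reports N t t' /\
      exists a b, [/\ can_report (t i) a, can_report (t i) b
        & f rm (update t' i a) <> f rm (update t' i b)].

End Networks.

(* Main.v *)
Require Import Defs.
From mathcomp Require Import all_boot all_order all_algebra finmap.
From mathcomp Require Import boolp classical_sets interval_inference reals.

(** Call the voters at distance 1 of the moderator hosts, those of them who
    invite somebody inviters, and the voters at distance 2 guests.  The outcome is
      min (min over inviters, max (min over the other hosts, max over guests))
    of the reported peaks.  For a fixed c > 0 the outcome is at least c iff every
    inviter has a peak >= c and, moreover, every other host or some guest has a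
    peak >= c.  By inviting more voters a host can only become pivotal in this
    ballot, or leave its result unchanged, for every c; hence hiding children
    never pays.  The outcome lies between the extreme peaks of the participants.
    A guest of the host j is relevant when all the other hosts withhold their
    invitations, which needs another host. *)

Set Implicit Arguments.
Unset Strict Implicit.
Unset Printing Implicit Defensive.

Import Order.TTheory GRing.Theory Num.Theory.
Local Open Scope fset_scope.
Local Open Scope ring_scope.

(** * Threshold tests for iterated minima and maxima *)

Lemma le_bigmin_seqE d (T : orderType d) (I : Type) (r : seq I) (P : pred I)
    (F : I -> T) (c x : T) : (c <= x)%O ->
  (c <= \big[Order.min/x]_(i <- r | P i) F i)%O =
    all (fun i => P i ==> (c <= F i)%O) r.
Proof.
move=> cx; elim: r => [|i r IHr]; first by rewrite big_nil.
by rewrite big_cons /=; case: (P i) => //=; rewrite le_min IHr.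
Qed.

(** Since [x < c], the default [x] fails the test, in agreement with [has] on the empty sequence. *)
Lemma le_bigmax_seqE d (T : orderType d) (I : Type) (r : seq I)
    (F : I -> T) (c x : T) : (x < c)%O ->
  (c <= \big[Order.max/x]_(i <- r) F i)%O = has (fun i => (c <= F i)%O) r.
Proof.
move=> xc; elim: r => [|i r IHr]; first by rewrite big_nil leNgt xc.
by rewrite big_cons /= le_max IHr.
Qed.

(** * Single-peaked preferences on the unit interval *)

Section Outcomes.
Variable R : realType.
Implicit Types (c x y z p : outcome R) (w : sp_preference R).

Definition bot : outcome R := 0%:i01.
Definition top : outcome R := 1%:i01.

Lemma bot_le x : bot <= x.
Proof. by rewrite -num_le /=. Qed.

Lemma le_top x : x <= top.
Proof. by rewrite -num_le /=. Qed.

Lemma bot_lt_top : bot < top.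
Proof. by rewrite -num_lt /=. Qed.

Definition peak w : outcome R := projT1 (cid (weakly_single_peaked w)).

Lemma peakP w : is_peak w (peak w).
Proof. by rewrite /peak; case: cid. Qed.

Lemma is_peak_unique w p q : is_peak w p -> is_peak w q -> p = q.
Proof.
move=> wp wq; case: (ltgtP p q) => // pq.
- by have [_] := wp p q (or_introl (conj (lexx _) pq));
    have [? _] := wq q p (or_intror (conj pq (lexx _))).
- by have [_] := wq q p (or_introl (conj (lexx _) pq));
    have [? _] := wp p q (or_intror (conj pq (lexx _))).
Qed.

Lemma weakly_refl w x : w x x.
Proof. by case: (weakly_complete w x x). Qed.

(** The conditions place [x] between the peak and [y], so single-peakedness alone ranks the two. *)
Lemma weakly_toward_peak w x y :
  (x < peak w -> y <= x) -> (peak w < x -> x <= y) -> w x y.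
Proof.
move=> xlt xgt; have [->|/eqP xy] := pselect (x = y); first exact: weakly_refl.
suff [] : strict w x y by [].
apply: peakP; case: (ltgtP x (peak w)) => xp.
- by right; split=> //; rewrite lt_neqAle eq_sym xy xlt.
- by left; split=> //; rewrite lt_neqAle xy xgt.
- by case: (ltgtP x y) xy => // xy _; [left|right].
Qed.

(** Distance to [p] realizes any prescribed peak; the reports that witness voter relevance are built
    from it. *)
Definition nearer p x y := `|x%:num - p%:num| <= `|y%:num - p%:num|.

Lemma nearer_single_peaked p : is_peak (nearer p) p.
Proof.
move=> x y xy; rewrite /strict /nearer.
suff h : `|x%:num - p%:num| < `|y%:num - p%:num|.
  by split; [exact: ltW | apply/negP; rewrite -ltNge].
case: xy => -[]; rewrite -num_le -num_lt => h1 h2.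
- rewrite !ger0_norm ?subr_ge0 ?ltrD2r //; exact: le_trans h1 (ltW h2).
- rewrite !ler0_norm ?subr_le0 ?ltrN2 ?ltrD2r //; exact: le_trans (ltW h1) h2.
Qed.

Definition nearer_pref p : sp_preference R.
Proof.
exists (nearer p).
- by move=> x y; apply/orP; exact: le_total.
- by move=> x y z; exact: le_trans.
- by exists p; exact: nearer_single_peaked.
Defined.

Lemma peak_nearer p : peak (nearer_pref p) = p.
Proof.
apply: (@is_peak_unique (nearer_pref p)); first exact: peakP.
exact: nearer_single_peaked.
Qed.

End Outcomes.

(** * Paths and the first two levels of the network *)

Section Trees.
Variables (R : realType) (V : choiceType).
Implicit Types (rm N : {fset V}) (t : profile R V).

Lemma path_reports N rm t t' i s : social_network N rm t -> reports N t t' ->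
  path_to rm t' i s -> path_to rm t i s /\ i \in N.
Proof.
move=> [rmN chN _] rep /andP[ps /eqP ls].
(* Reports are constrained only inside [N], so the induction carries membership in [N] along the
   path. *)
pose inN (u : option V) := if u is Some j then j \in N else true.
suff H u : inN u -> path (edge rm t') u s ->
    path (edge rm t) u s /\ inN (last u s).
  by have [//|ps' ] := H None _ ps; rewrite ls => iN; rewrite /path_to ps' ls eqxx.
elim: s u {ps ls} => //= v s IHs u uN /andP[uv ps].
have [uv' vN] : edge rm t u v /\ inN v.
  case: u v uN uv {ps} => [j|] [k|] //= uN uv; last by split=> //; exact: (fsubsetP rmN).
  have kj := fsubsetP (rep _ uN) _ uv.
  by split=> //; have := fsubsetP (chN _ uN) _ kj; rewrite !inE => /andP[].
by have [? ?] := IHs v vN ps; rewrite uv'.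
Qed.

(** Withheld invitations destroy paths but create none, so uniqueness passes from the true tree to
    the reported network. *)
Lemma path_unique rm t i s s' : reported_profile rm t ->
  path_to rm t i s -> path_to rm t i s' -> s = s'.
Proof.
move=> [N [t0 [net rep]]] /(path_reports net rep)[ps iN] /(path_reports net rep)[ps' _].
by have [_ _ /(_ _ iN)[s0 [_ uniq]]] := net; rewrite -(uniq _ ps) -(uniq _ ps').
Qed.

Lemma N_D1P rm t i : N_D rm t 1 i <-> i \in rm.
Proof.
split=> [[[|u []]] //|irm]; last by exists [:: Some i]; rewrite // /path_to /= irm eqxx.
by rewrite /path_to /= andbT => /andP[+ /eqP uE]; rewrite uE.
Qed.

Definition guests rm t : {fset V} := \bigcup_(j <- rm) children (t j).

Lemma guestsP rm t i :
  reflect (exists2 j, j \in rm & i \in children (t j)) (i \in guests rm t).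
Proof.
by apply: (iffP (bigfcupP _ _ _ _)) => -[j jrm ij]; exists j => //;
  move: jrm; rewrite ?andbT.
Qed.

Lemma N_D2P rm t i : N_D rm t 2 i <-> i \in guests rm t.
Proof.
split=> [[[|u [|v []]]] //|/guestsP[j jrm ij]]; last first.
  by exists [:: Some j; Some i]; rewrite // /path_to /= jrm ij eqxx.
rewrite /path_to /= andbT => /andP[/andP[urm uv] /eqP vE] _.
by apply/guestsP; case: u urm uv => // j jrm; rewrite vE; exists j.
Qed.

Lemma N_D_unique rm t d d' i : reported_profile rm t ->
  N_D rm t d i -> N_D rm t d' i -> d = d'.
Proof. by move=> rep [s ps <-] [s' ps' <-]; rewrite (path_unique rep ps ps'). Qed.

Lemma truthful_reported N rm t :
  social_network N rm t -> reported_profile rm t.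
Proof. by move=> net; exists N, t; split=> // i _; exact: fsubset_refl. Qed.

Lemma guest_not_host rm t i :
  reported_profile rm t -> i \in guests rm t -> i \notin rm.
Proof.
move=> rep /N_D2P i2; apply/negP => /(N_D1P _ t) i1.
by have := N_D_unique rep i1 i2.
Qed.

Lemma host_participant rm t i : i \in rm -> participants rm t i.
Proof. by move=> /(N_D1P _ t)[s ps _]; exists s. Qed.

Lemma guest_participant rm t i : i \in guests rm t -> participants rm t i.
Proof. by move=> /N_D2P[s ps _]; exists s. Qed.

Lemma participant_host rm t i : participants rm t i -> exists j, j \in rm.
Proof.
move=> [[|[j|] s]]; rewrite /path_to //= => /andP[/andP[jrm _] _].
by exists j.
Qed.

End Trees.

(** * The mechanism and its properties *)

Section Mechanism.
Variables (R : realType) (V : choiceType).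
Implicit Types (rm N : {fset V}) (t : profile R V) (c : outcome R).

Definition peak_of t i : outcome R := peak (pref (t i)).

(** The defaults treat empty groups as intended: without other hosts the inner maximum is [top] and
    the inviters decide; without guests there are no inviters, and the minimum over all hosts
    remains. *)
Definition facility rm t : outcome R :=
  Order.min (\big[Order.min/top R]_(i <- rm | children (t i) != fset0) peak_of t i)
    (Order.max (\big[Order.min/top R]_(i <- rm | children (t i) == fset0) peak_of t i)
      (\big[Order.max/bot R]_(i <- guests rm t) peak_of t i)).

Definition approved rm t c : Prop :=
  (forall i, i \in rm /\ children (t i) != fset0 -> c <= peak_of t i) /\
  ((forall i, i \in rm /\ children (t i) = fset0 -> c <= peak_of t i) \/
   exists2 i, i \in guests rm t & c <= peak_of t i).

Lemma le_facilityP rm t c :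
  bot R < c -> c <= facility rm t <-> approved rm t c.
Proof.
move=> c_gt0; rewrite le_min le_max !le_bigmin_seqE ?le_top // le_bigmax_seqE //.
split=> [/andP[/allP inv oth]|[inv oth]].
  split=> [i [irm ich]|]; first exact: (implyP (inv _ irm)).
  case/orP: oth => [/allP oth|/hasP[i ? ?]]; last by right; exists i.
  by left=> i [irm ich]; apply: (implyP (oth _ irm)); rewrite ich.
apply/andP; split; first by apply/allP => i irm; apply/implyP => ich; exact: inv.
apply/orP; case: oth => [oth|[i ? ?]]; [left|right]; last by apply/hasP; exists i.
by apply/allP => i irm; apply/implyP => /eqP ich; exact: oth.
Qed.

(** Each outcome passes its own ballot, hence the ballot of the other profile at the same
    threshold. *)
Lemma facility_eq rm t rm' t' : (forall c, approved rm t c <-> approved rm' t' c) ->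
  facility rm t = facility rm' t'.
Proof.
move=> E; apply/le_anti/andP; split.
- have [//|gt0] := leP (facility rm t) (bot R); first by move/le_trans; apply; exact: bot_le.
  by apply/le_facilityP/E/le_facilityP.
- have [//|gt0] := leP (facility rm' t') (bot R); first by move/le_trans; apply; exact: bot_le.
  by apply/le_facilityP/E/le_facilityP.
Qed.

Lemma facility_local rm t t' : (forall i, participants rm t i -> t i = t' i) ->
  facility rm t = facility rm t'.
Proof.
move=> E.
have Eh i : i \in rm -> t i = t' i by move=> ?; exact/E/host_participant.
have Eg : guests rm t = guests rm t'.
  by apply: eq_big_seq => i irm /=; rewrite Eh.
have Egt i : i \in guests rm t -> t i = t' i by move=> ?; exact/E/guest_participant.
apply: facility_eq => c; rewrite /approved -Eg /peak_of.
split=> -[inv oth]; (split=> [i [irm]|]; [by move: (inv i); rewrite Eh //; auto|]);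
  (case: oth => [oth|[i ig ci]]; [left=> i [irm]; by move: (oth i); rewrite Eh //; auto|]);
  by right; exists i => //; move: ci; rewrite Egt.
Qed.

Definition facility_scf : scf R V := SCF facility_local.

(** Truth-telling helps approval of thresholds up to the peak [p] ([up]) and hinders it above
    ([down]), so the truthful outcome lies between [p] and the outcome of any misreport. *)
Lemma facility_SP : SP facility_scf.
Proof.
move=> N rm t t' i net iN rep /=; set p := peak (pref (t i)).
set t'' := update t' i (t i).
have t''i : t'' i = t i by rewrite /t'' /update eqxx.
have t''E j : j <> i -> t'' j = t' j by rewrite /t'' /update => /eqP/negbTE ->.
have ch j : children (t' j) `<=` children (t'' j).
  by have [->|/t''E ->] := pselect (j = i); rewrite ?t''i; [exact: rep|].
have chg : guests rm t' `<=` guests rm t''.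
  apply/fsubsetP => k /guestsP[j jrm kj]; apply/guestsP; exists j => //.
  exact: fsubsetP (ch j) _ kj.
have pk'' : peak_of t'' i = p by rewrite /peak_of t''i.
have pkE j : j <> i -> peak_of t'' j = peak_of t' j by move=> /t''E; rewrite /peak_of => ->.
(* Revealing children can turn [i] into an inviter, who then approves [c], and can only enlarge the
   set of guests. *)
have up c : c <= p -> approved rm t' c -> approved rm t'' c.
  move=> cp [inv oth]; split=> [j [jrm jch]|].
    have [->|ji] := pselect (j = i); first by rewrite pk''.
    by rewrite pkE //; apply: inv; rewrite -t''E.
  case: oth => [oth|[k kg ck]]; [left=> j [jrm jch]|right; exists k].
  - have [->|ji] := pselect (j = i); first by rewrite pk''.
    by rewrite pkE //; apply: oth; rewrite -t''E.
  - exact: fsubsetP kg.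
  - by have [->|ki] := pselect (k = i); rewrite ?pk'' ?pkE.
have down c : p < c -> approved rm t'' c -> approved rm t' c.
  move=> pc [inv oth].
  (* As an inviter, [i] would veto [c] above her peak. So a host [i] has no child to withhold, and
     both reports give the same guests. *)
  have no_inv : i \in rm -> children (t'' i) = fset0.
    move=> irm; apply/eqP/negPn/negP => ich.
    by have := inv i (conj irm ich); rewrite pk'' leNgt pc.
  split=> [j [jrm jch]|].
    have [ji|ji] := pselect (j = i); last by rewrite -pkE //; apply: inv; rewrite t''E.
    move: jch jrm; rewrite ji => + irm; have := ch i.
    by rewrite no_inv // fsubset0 => ->.
  case: oth => [oth|[k kg ck]]; [left=> j [jrm jch]|right; exists k].
  - have [ji|ji] := pselect (j = i); last by rewrite -pkE //; apply: oth; rewrite t''E.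
    move: jrm; rewrite ji => irm.
    by have := oth i (conj irm (no_inv irm)); rewrite pk'' leNgt pc.
  - case/guestsP: kg => j jrm kj; apply/guestsP; exists j => //.
    have [ji|ji] := pselect (j = i); last by rewrite -t''E.
    by move: kj jrm; rewrite ji => + irm; rewrite no_inv.
  - by rewrite -pkE // => ki; move: ck; rewrite ki pk'' leNgt pc.
apply: weakly_toward_peak; rewrite -/p => zp.
- rewrite leNgt; apply/negP => lt.
  (* This threshold is reached under the misreport, is at most [p] so that [up] applies, and exceeds
     the truthful outcome. *)
  set c := Order.min (facility rm t') p.
  have lec : facility rm t'' < c by rewrite lt_min lt.
  have c_gt0 : bot R < c by apply: le_lt_trans (bot_le _) lec.
  suff : c <= facility rm t'' by rewrite leNgt lec.
  apply/le_facilityP/up => //; first by rewrite ge_min lexx orbT.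
  by apply/le_facilityP => //; rewrite ge_min lexx.
- have c_gt0 : bot R < facility rm t'' by apply: le_lt_trans (bot_le _) zp.
  by apply/le_facilityP/down => //; apply/le_facilityP.
Qed.

(** An improvement below the outcome would need all peaks strictly below it, yet some approving
    participant reaches it. An improvement above would need all peaks strictly above it, yet the
    lowest host peak is not. *)
Lemma facility_PE : PE facility_scf.
Proof.
move=> rm t _ [o [/= weak [i0 pi0 [_ not_weak]]]].
(* A host is needed because approval by empty groups would exhibit no peak. *)
have [h hrm] := participant_host pi0.
case: (ltgtP o (facility rm t)) => [lt|gt|oE]; last by move: not_weak; rewrite oE;
  apply; exact: weakly_refl.
- have far i : participants rm t i -> peak_of t i < facility rm t.
    move=> pi; rewrite ltNge; apply/negP => le.
    by have [_] := @peakP _ (pref (t i)) _ _ (or_intror (conj lt le)); apply; exact: weak.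
  have z_gt0 : bot R < facility rm t by apply: le_lt_trans (bot_le _) lt.
  have /le_facilityP[//|inv oth] := lexx (facility rm t).
  have farP i : participants rm t i -> ~ (facility rm t <= peak_of t i).
    by move=> /far; rewrite ltNge => /negP.
  have [hE|hne] := eqVneq (children (t h)) fset0; last first.
    by apply: (farP h (host_participant _ hrm)); exact: inv.
  case: oth => [oth|[k kg ck]]; last exact: farP (guest_participant kg) ck.
  by apply: (farP h (host_participant _ hrm)); exact: oth.
- have far i : participants rm t i -> facility rm t < peak_of t i.
    move=> pi; rewrite ltNge; apply/negP => le.
    by have [_] := @peakP _ (pref (t i)) _ _ (or_introl (conj le gt)); apply; exact: weak.
  (* Both minima in [facility] run over subsets of the hosts. *)
  have : \big[Order.min/top R]_(i <- rm) peak_of t i <= facility rm t.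
    rewrite /facility le_min le_max.
    by rewrite !sub_bigmin.
  apply/negP; rewrite -ltNge big_seq; apply: lt_bigmin.
    exact: lt_le_trans gt (le_top _).
  by move=> i irm; apply: far; exact: host_participant.
Qed.

Lemma forall_bij (s : V -> V) (P Q : V -> Prop) : bijective s ->
  (forall i, P (s i) <-> P i) ->
  (forall i, P i -> Q (s i)) <-> (forall i, P i -> Q i).
Proof.
move=> [g sK gK] Ps; split=> H i Pi; last by apply/H/Ps.
by rewrite -(gK i); apply/H/Ps; rewrite gK.
Qed.

(** A moved voter and her image share distance and number of children, so [s] preserves the
    inviters, the other hosts and the guests; each ballot ignores the order within these groups. *)
Lemma facility_AN_SD : AN_SD facility_scf.
Proof.
move=> rm t k d s rep bij_s fix_s /=.
have class_s i : s i <> i ->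
    (N_S rm t k `&` N_D rm t d)%classic i /\ (N_S rm t k `&` N_D rm t d)%classic (s i).
  move=> sii; split; apply: contrapT => /fix_s // ssi.
  (* If [s] fixed [s i], injectivity would make it fix [i]. *)
  by apply/sii/(bij_inj bij_s).
have host_s i : (s i \in rm) = (i \in rm).
  have [->//|/class_s[[_ di] [_ dsi]]] := pselect (s i = i).
  by apply/idP/idP => /(N_D1P _ t) d1; apply/(N_D1P _ t);
    [rewrite -(N_D_unique rep dsi d1)|rewrite -(N_D_unique rep di d1)].
have guest_s i : (s i \in guests rm t) = (i \in guests rm t).
  have [->//|/class_s[[_ di] [_ dsi]]] := pselect (s i = i).
  by apply/idP/idP => /N_D2P d1; apply/N_D2P;
    [rewrite -(N_D_unique rep dsi d1)|rewrite -(N_D_unique rep di d1)].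
have leaf_s i : (children (t (s i)) == fset0) = (children (t i) == fset0).
  have [->//|/class_s[[[_ ki] _] [[_ ksi] _]]] := pselect (s i = i).
  by rewrite -!cardfs_eq0 ki ksi.
apply: facility_eq => c; rewrite /approved.
have inv := @forall_bij s (fun i => i \in rm /\ children (t i) != fset0)
  (fun i => c <= peak_of t i) bij_s.
have oth := @forall_bij s (fun i => i \in rm /\ children (t i) = fset0)
  (fun i => c <= peak_of t i) bij_s.
have gst := @forall_bij s (fun i => i \in guests rm t)
  (fun i => ~ c <= peak_of t i) bij_s.
(* The approving guest becomes a negated universal, so that [forall_bij] applies to it too. *)
have exE (P Q : V -> Prop) : (exists2 i, P i & Q i) <-> ~ (forall i, P i -> ~ Q i).
  split=> [[i Pi Qi] /(_ i Pi)//|H]; apply: contrapT => nex; apply: H => i Pi Qi.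
  by apply: nex; exists i.
rewrite !exE.
have gE : guests rm (permute_prefs s t) = guests rm t by [].
rewrite gE /peak_of /= in inv oth gst *.
rewrite inv ?oth ?gst //= => i; rewrite ?host_s ?guest_s ?leaf_s //.
by split=> -[? /eqP ch]; split=> //; apply/eqP; move: ch; rewrite leaf_s.
Qed.

Lemma facility_VR N rm t : social_network N rm t ->
  (#|` rm| = 1%N -> N_D rm t 2 = set0) -> VR 2 facility_scf N rm t.
Proof.
move=> net lone [|[|[|//]]] i //= _ iD.
all: pose leaf x : vtype R V := VType (nearer_pref x) fset0.
all: have leafR a x : can_report a (leaf x) by exact: fsub0set.
all: have topgt : (top R <= bot R) = false by rewrite leNgt bot_lt_top.
- have irm : i \in rm by exact/(N_D1P _ t).
  (* With no invitations the outcome is the lowest host peak, and [i] alone can lower it from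
     [top]. *)
  exists (fun=> leaf (top R)); split=> [j jN|]; first exact: leafR.
  exists (leaf (bot R)), (leaf (top R)); split=> // E.
  set t0 := update _ i _ in E; set t1 := update _ i _ in E.
  have t1E j : t1 j = leaf (top R) by rewrite /t1 /update; case: ifP.
  have t0i : t0 i = leaf (bot R) by rewrite /t0 /update eqxx.
  have t0ch j : children (t0 j) = fset0 by rewrite /t0 /update; case: ifP.
  have : approved rm t1 (top R).
    by split=> [j [_]|]; [|left=> j _]; rewrite ?/peak_of t1E ?eqxx ?peak_nearer.
  move/le_facilityP => /(_ (bot_lt_top R)); rewrite -E => /le_facilityP.
  move=> /(_ (bot_lt_top R))[_ [/(_ i)|[k /guestsP[j _]]]]; last by rewrite t0ch.
  by rewrite /peak_of t0i peak_nearer topgt => /(_ (conj irm erefl)).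
- have ig : i \in guests rm t by exact/N_D2P.
  have hg := guest_not_host (truthful_reported net).
  have /guestsP[h hrm ih] := ig.
  have [h' h'rm h'h] : exists2 h', h' \in rm & h' <> h.
    apply: contrapT => nex.
    have : N_D rm t 2 = set0.
      apply/lone/eqP/cardfs1P; exists h; apply/fsetP => j; rewrite inE.
      apply/idP/eqP => [jrm|-> //].
      by apply: contrapT => jh; apply: nex; exists j.
    by move=> D0; move: iD; rewrite D0.
  have hi : h <> i by move=> hi; move: (hg _ ig); rewrite -hi hrm.
  have h'i : h' <> i by move=> h'i; move: (hg _ ig); rewrite -h'i h'rm.
  (* Only [h] invites, and she approves [top]; the host [h'] rejects it, so approval rests on the
     guests, among whom only [i] may report [top]. *)
  pose t' := update (fun=> leaf (bot R)) h (VType (nearer_pref (top R)) (children (t h))).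
  exists t'; split=> [j jN|].
    rewrite /t' /update; case: eqP => [->|_]; last exact: leafR.
    exact: fsubset_refl.
  exists (leaf (bot R)), (leaf (top R)); split=> // E.
  set t0 := update _ i _ in E; set t1 := update _ i _ in E.
  have t1i : t1 i = leaf (top R) by rewrite /t1 /update eqxx.
  have t1h : t1 h = VType (nearer_pref (top R)) (children (t h)).
    by rewrite /t1 /t' /update eqxx; case: eqP.
  have t0h : t0 h = VType (nearer_pref (top R)) (children (t h)).
    by rewrite /t0 /t' /update eqxx; case: eqP.
  have t0E j : j <> h -> t0 j = leaf (bot R).
    by rewrite /t0 /t' /update => /eqP/negbTE ->; case: ifP.
  have t1E j : j <> h -> children (t1 j) = fset0.
    by rewrite /t1 /t' /update => /eqP/negbTE ->; case: ifP.
  have : approved rm t1 (top R).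
    split=> [j [_]|].
      have [->|jh] := pselect (j = h); first by rewrite /peak_of t1h peak_nearer.
      by rewrite t1E // eqxx.
    right; exists i; last by rewrite /peak_of t1i peak_nearer.
    by apply/guestsP; exists h => //; rewrite t1h.
  move/le_facilityP => /(_ (bot_lt_top R)); rewrite -E => /le_facilityP.
  move=> /(_ (bot_lt_top R))[_ [/(_ h')|[k /guestsP[j jrm kj]]]].
    by rewrite /peak_of t0E // peak_nearer topgt => /(_ (conj h'rm erefl)).
  have [jh|jh] := pselect (j = h); last by move: kj; rewrite t0E.
  (* Under [t0] only [h] approves [top], and a host is never a guest. *)
  rewrite /peak_of t0E ?peak_nearer ?topgt // => kh.
  have kg : k \in guests rm t by apply/guestsP; exists h => //; move: kj; rewrite jh t0h.
  by move: (hg _ kg); rewrite kh hrm.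
Qed.

End Mechanism.

Theorem theorem5 (R : realType) (V : choiceType) :
  exists f : scf R V,
    [/\ SP f, PE f, AN_SD f
      & forall (N rm : {fset V}) (t : profile R V),
          social_network N rm t ->
          (#|` rm|%fset = 1%N -> N_D rm t 2 = set0) ->
          VR 2 f N rm t].
Proof.
exists (facility_scf R V); split.
- exact: facility_SP.
- exact: facility_PE.
- exact: facility_AN_SD.
- exact: facility_VR.
Qed.
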